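(* For every $n$ divisible by $4$ there exists a distribution $\mathcal D_n$ over permutations of $[n]$ such that $\mathrm{val}_{\mathcal D_n}(\ast,\iota)=1$, but there is an absolute constant $C$ such that every deterministic comparison-based algorithm $\mathrm{ALG}$ whose stopping rule can be computed by circuits of size $2^{n/8}$ satisfies $\mathrm{val}_{\mathcal D_n}(\mathrm{ALG},\iota)\le C/n$.
   Context: Items are $[n]$. Nature draws an arrival order $\pi\sim\mathcal D_n$, where $\pi(i)$ is the arrival time of item $i$. The adversary's ordering of items by value is a permutation $\sigma$ of $[n]$, where $\sigma(j)$ is the item with the $j$-th largest value; $\iota$ denotes the identity permutation (item $1$ has the largest value, item $n$ the smallest). An online algorithm sees items in arrival order and at each time irrevocably decides whether to select the current item (at most one selection); comparison-based means the decision at time $t$ depends only on the relative order by value of the first $t$ arrived items. Its stopping rule is the function mapping this relative order (encoded, e.g., as the bit string of pairwise comparisons among the first $t$ items) to the decision at time $t$; it is computable by circuits of size $s$ if for each $t$ there is a Boolean circuit (AND/OR/NOT gates) of size at most $s$ computing it. $\mathrm{val}_{\mathcal D}(\mathrm{ALG},\sigma)$ is the probability that ALG selects the maximum-value item when values are ordered by $\sigma$ and $\pi\sim\mathcal D$; $\mathrm{val}_{\mathcal D}(\ast,\sigma)=\max_{\mathrm{ALG}}\mathrm{val}_{\mathcal D}(\mathrm{ALG},\sigma)$. *)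

(* Defs.v *)
From mathcomp Require Import all_boot all_order all_fingroup all_algebra.
From mathcomp Require Import reals exp.

Set Implicit Arguments.
Unset Strict Implicit.
Unset Printing Implicit Defensive.

Import Order.TTheory GRing.Theory Num.Theory.

Local Open Scope ring_scope.

(** Boolean circuits: size is the number of gates, AND and OR have fan-in two,
    and inputs and constants are free sources. Constants are needed since at
    the first arrival there is no input bit at all. *)

(* [GateOut i] reads the [i]-th of the [k] gates built so far. *)
Inductive wire (X : Type) (k : nat) : Type :=
  | Input of X
  | Const of bool
  | GateOut of 'I_k.

Inductive gate (X : Type) (k : nat) : Type :=
  | Not of wire X k
  | And of wire X k & wire X k
  | Or of wire X k & wire X k.

(* A list of gates in topological order: a new gate reads only earlier ones. *)
Inductive gates (X : Type) : nat -> Type :=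
  | NoGate : gates X 0
  | AddGate k : gates X k -> gate X k -> gates X k.+1.

Record circuit (X : Type) (s : nat) : Type :=
  Circuit { circuit_gates : gates X s; circuit_output : wire X s }.

Definition wire_eval (X : Type) k (x : X -> bool) (v : seq bool)
    (w : wire X k) : bool :=
  match w with
  | Input i => x i
  | Const b => b
  | GateOut i => nth false v i
  end.

Definition gate_eval (X : Type) k (x : X -> bool) (v : seq bool)
    (g : gate X k) : bool :=
  match g with
  | Not w => ~~ wire_eval x v w
  | And w1 w2 => wire_eval x v w1 && wire_eval x v w2
  | Or w1 w2 => wire_eval x v w1 || wire_eval x v w2
  end.

Fixpoint gates_eval (X : Type) k (x : X -> bool) (gs : gates X k) : seq bool :=
  match gs with
  | NoGate => [::]
  | AddGate _ gs' g =>
      let v := gates_eval x gs' in rcons v (gate_eval x v g)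
  end.

Definition circuit_eval (X : Type) s (c : circuit X s) (x : X -> bool) : bool :=
  wire_eval x (gates_eval x (circuit_gates c)) (circuit_output c).

(** Items, value ranks and arrival times are all elements of ['I_n], counted
    from 0. *)

Definition cmp_pair (t : nat) : finType := {p : 'I_t * 'I_t | (p.1 < p.2)%N}.

Definition cmp_bits (t : nat) : finType := {ffun cmp_pair t -> bool}.

(* Here [pi i] is the arrival time of item [i] and [sigma j] is the item of
   value rank [j], rank 0 being the largest value; so this is the value rank
   of the item that arrives at time [t]. *)
Definition rank_at n (pi sigma : {perm 'I_n}) (t : 'I_n) : 'I_n :=
  (sigma^-1)%g ((pi^-1)%g t).

(* The relative order of the items that arrived at times 0, ..., t. Bit (a, b)
   says that the item that arrived at time a has a larger value than the one
   that arrived at time b. *)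
Definition rel_order n (pi sigma : {perm 'I_n}) (t : 'I_n) : cmp_bits t.+1 :=
  [ffun p : cmp_pair t.+1 =>
     (rank_at pi sigma (widen_ord (ltn_ord t) (val p).1)
        < rank_at pi sigma (widen_ord (ltn_ord t) (val p).2))%N].

(* A deterministic comparison-based algorithm, given by its stopping rule. *)
Definition algorithm (n : nat) : finType :=
  {dffun forall t : 'I_n, {ffun cmp_bits t.+1 -> bool}}.

Definition accepts n (ALG : algorithm n) (pi sigma : {perm 'I_n})
    (t : 'I_n) : bool :=
  ALG t (rel_order pi sigma t).

(* Selection is irrevocable: the selected item is the first accepted one. *)
Definition selects_at n (ALG : algorithm n) (pi sigma : {perm 'I_n})
    (t : 'I_n) : bool :=
  accepts ALG pi sigma t
  && [forall s : 'I_n, (s < t)%N ==> ~~ accepts ALG pi sigma s].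

Definition selects_max n (ALG : algorithm n) (pi sigma : {perm 'I_n}) : bool :=
  [exists t : 'I_n,
     selects_at ALG pi sigma t && (rank_at pi sigma t == 0%N :> nat)].

(* The circuits need only be correct on bit strings that encode an order. *)
Definition computable_by_circuits (R : realType) n (ALG : algorithm n)
    (s : R) : Prop :=
  forall t : 'I_n,
    exists (k : nat) (c : circuit (cmp_pair t.+1) k),
      k%:R <= s /\
      forall pi sigma : {perm 'I_n},
        circuit_eval c (rel_order pi sigma t) = ALG t (rel_order pi sigma t).

Definition is_distribution (R : realType) n (D : {ffun {perm 'I_n} -> R}) :
    Prop :=
  (forall pi, 0 <= D pi) /\ \sum_pi D pi = 1.

Definition alg_val (R : realType) n (D : {ffun {perm 'I_n} -> R})
    (ALG : algorithm n) (sigma : {perm 'I_n}) : R :=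
  \sum_(pi | selects_max ALG pi sigma) D pi.

(* The default 0 is harmless: [alg_val] is nonnegative for a distribution. *)
Definition opt_val (R : realType) n (D : {ffun {perm 'I_n} -> R})
    (sigma : {perm 'I_n}) : R :=
  \big[Num.max/0]_(ALG : algorithm n) alg_val D ALG sigma.

(* Main.v *)
Require Import Defs.
From mathcomp Require Import all_boot all_order all_fingroup all_algebra.
From mathcomp Require Import reals sequences exp.
From mathcomp Require Import zify ring lra.

(** Let n = 2h. The first h arrivals are the h worst items in an order encoding
    a uniform permutation y of h letters; afterwards the items arrive in
    increasing order of value, except that the best one arrives at time f(y).
    Before and at time f(y) each late item is a new record, so the comparisons
    seen so far reveal y but not f(y). An unrestricted algorithm computes f(y)
    from y and always wins. For fixed stopping rules a random f agrees with the
    induced guess on about a 1/h fraction of the h! inputs, and an exponential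
    moment bound beats the union over all circuits of size 2^n, of which there
    are only exp(c^n) while h! grows faster than c^n for every constant c. *)

Set Implicit Arguments.
Unset Strict Implicit.
Unset Printing Implicit Defensive.

Import Order.TTheory GRing.Theory Num.Theory.
Local Open Scope ring_scope.

(** * Finite codes for circuits, and their number *)

(** A single bound [S] on gate indices, in place of the dependent one, puts all circuits of size at
    most [S] in one finite type. A forward reference evaluates to the default [false]. *)
Definition wire_code (X : finType) (S : nat) : finType :=
  (X + bool + 'I_S)%type.

Definition gate_code (X : finType) (S : nat) : finType :=
  (wire_code X S + wire_code X S * wire_code X S
   + wire_code X S * wire_code X S)%type.

Definition circuit_code (X : finType) (S : nat) : finType :=
  ('I_S.+1 * S.-tuple (gate_code X S) * wire_code X S)%type.

Definition wire_decode (X : finType) S (w : wire_code X S) : wire X S :=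
  match w with
  | inl (inl i) => Input S i
  | inl (inr b) => Const X S b
  | inr k => GateOut X k
  end.

Definition gate_decode (X : finType) S (g : gate_code X S) : gate X S :=
  match g with
  | inl (inl w) => Not (wire_decode w)
  | inl (inr (w1, w2)) => And (wire_decode w1) (wire_decode w2)
  | inr (w1, w2) => Or (wire_decode w1) (wire_decode w2)
  end.

Definition run (X : finType) S (x : X -> bool) (s : seq (gate_code X S)) :=
  foldl (fun v g => rcons v (gate_eval x v (gate_decode g))) [::] s.

(* The first component is the number of gates in use; the others are padding. *)
Definition code_eval (X : finType) S (c : circuit_code X S) (x : X -> bool) :=
  wire_eval x (run x (take c.1.1 c.1.2)) (wire_decode c.2).

Lemma wire_codeP (X : Type) (Y : finType) (phi : X -> Y) S k (w : wire X k) :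
  (k <= S)%N -> exists w' : wire_code Y S, forall x y v,
    (forall i, x i = y (phi i)) ->
    wire_eval x v w = wire_eval y v (wire_decode w').
Proof.
move=> kS; case: w => [i|b|i].
- by exists (inl (inl (phi i))) => x y v /= ->.
- by exists (inl (inr b)).
- by exists (inr (widen_ord kS i)).
Qed.

Lemma gate_codeP (X : Type) (Y : finType) (phi : X -> Y) S k (g : gate X k) :
  (k <= S)%N -> exists g' : gate_code Y S, forall x y v,
    (forall i, x i = y (phi i)) ->
    gate_eval x v g = gate_eval y v (gate_decode g').
Proof.
move=> kS; case: g => [w|w1 w2|w1 w2].
- have [w' E] := wire_codeP phi w kS.
  by exists (inl (inl w')) => x y v xy /=; rewrite (E x y).
- have [w1' E1] := wire_codeP phi w1 kS; have [w2' E2] := wire_codeP phi w2 kS.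
  by exists (inl (inr (w1', w2'))) => x y v xy /=; rewrite (E1 x y) ?(E2 x y).
- have [w1' E1] := wire_codeP phi w1 kS; have [w2' E2] := wire_codeP phi w2 kS.
  by exists (inr (w1', w2')) => x y v xy /=; rewrite (E1 x y) ?(E2 x y).
Qed.

Lemma gates_codeP (X : Type) (Y : finType) (phi : X -> Y) S k (gs : gates X k) :
  (k <= S)%N -> exists2 s : seq (gate_code Y S), size s = k &
    forall x y, (forall i, x i = y (phi i)) -> gates_eval x gs = run y s.
Proof.
elim: gs => [|{}k gs IH g] kS; first by exists [::].
have [s sz E] := IH (ltnW kS); have [g' Eg] := gate_codeP phi g (ltnW kS).
exists (rcons s g') => [|x y xy /=]; first by rewrite size_rcons sz.
by rewrite /run foldl_rcons -/(run y s) -(E x y) // (Eg x y).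
Qed.

(** [phi] renames inputs, so that circuits for different times, whose input types differ, get codes
    over one type. *)
Lemma circuit_codeP (X : Type) (Y : finType) (phi : X -> Y) S k
    (c : circuit X k) : (k <= S)%N ->
  exists c' : circuit_code Y S, forall x y,
    (forall i, x i = y (phi i)) -> circuit_eval c x = code_eval c' y.
Proof.
move=> kS; case: c => gs w.
have [s sz E] := gates_codeP phi gs kS; have [w' Ew] := wire_codeP phi w kS.
pose pad : gate_code Y S := inl (inl (inl (inr true))).
have szp : size (s ++ nseq (S - k) pad) == S.
  by rewrite size_cat size_nseq sz subnKC.
have kS1 : (k < S.+1)%N by [].
exists (Ordinal kS1, Tuple szp, w') => x y xy.
by rewrite /circuit_eval /code_eval /= take_size_cat // -(E x y) ?(Ew x y).
Qed.

(** With [2 ^ n] gates and [n * n] inputs, a wire takes at most [2n + 2] bits, and a gate takes two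
    wires and two more bits. *)
Lemma card_circuit_code_le (n : nat) : (0 < n)%N ->
  (#|circuit_code ('I_n * 'I_n)%type (2 ^ n)| <= 2 ^ (16 * n * 2 ^ n))%N.
Proof.
move=> n0; set X := ('I_n * 'I_n)%type; set S := (2 ^ n)%N.
have S2 : (2 <= S)%N by rewrite -{1}(expn1 2) leq_exp2l.
have nS : (n <= S)%N by apply/ltnW/ltn_expl.
have w_le : (#|wire_code X S| <= 2 ^ (2 * n + 2))%N.
  rewrite /wire_code !card_sum card_prod !card_ord card_bool.
  have -> : (2 ^ (2 * n + 2) = S * S * 4)%N.
    by rewrite /S -expnD -[4%N]/(2 ^ 2)%N -expnD; congr (2 ^ _)%N; lia.
  have : (n * n <= S * S)%N by exact: leq_mul.
  by nia.
have g_le : (#|gate_code X S| <= 2 ^ (4 * n + 6))%N.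
  rewrite /gate_code 2!card_sum !card_prod.
  have -> : (2 ^ (4 * n + 6) = 2 ^ (2 * n + 2) * 2 ^ (2 * n + 2) * 4)%N.
    by rewrite -!expnD -[4%N]/(2 ^ 2)%N -expnD; congr (2 ^ _)%N; lia.
  have := leq_mul w_le w_le; have : (0 < 2 ^ (2 * n + 2))%N by rewrite expn_gt0.
  move: w_le; set e := (2 ^ _)%N; move: #|wire_code X S| => w; nia.
rewrite /circuit_code 2!card_prod card_ord card_tuple.
apply: (@leq_trans (2 ^ (n + 1) * (2 ^ (4 * n + 6)) ^ S * 2 ^ (2 * n + 2))%N).
  rewrite !leq_mul // ?leq_exp2r //; last by lia.
  by rewrite expnD -/S; lia.
by rewrite -expnM -!expnD leq_exp2l //; nia.
Qed.

(** * Factorial growth and the random choice of [f] *)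

Lemma expn_le_fact (b : nat) :
  exists K : nat, forall h : nat, (b ^ h <= K * h`!)%N.
Proof.
case: b => [|b]; first by exists 1%N => -[|h] //; rewrite exp0n.
(* This [K] covers exponents up to [b.+1]; beyond, each new factor [h.+1] of the factorial is at
   least [b.+1]. *)
exists (b.+1 ^ b.+1)%N; elim=> [|h IH]; first by rewrite fact0 muln1 expn_gt0.
have [hb|bh] := leqP b h.
  rewrite expnS factS mulnCA leq_mul //.
by rewrite -[leqLHS]muln1 leq_mul ?fact_gt0 // leq_pexp2l // ltnW.
Qed.

(* Exponential moment method over a uniformly random [f]: the values [f x] are
   independent, so the moment of the number of agreements factorises. *)
Lemma hard_function (R : realType) (A T J : finType) (g : A -> T -> J -> bool)
    (L : R) :
  (0 < #|J|)%N ->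
  (forall a x j k, g a x j -> g a x k -> j = k) ->
  #|A|%:R <= expR L ->
  exists f : {ffun T -> J}, forall a,
    #|[set x | g a x (f x)]|%:R <= L + (expR 1 - 1) * (#|T|%:R / #|J|%:R).
Proof.
move=> J0 g_inj AL.
pose agree f a := #|[set x | g a x (f x)]|.
set M : R := (expR 1 - 1) * _.
have J0' : 0 < #|J|%:R :> R by rewrite ltr0n.
have e1 : 0 <= expR 1 - 1 :> R by have := expR_ge1Dx (1 : R); lra.
have agreeE (f : {ffun T -> J}) a :
    expR (agree f a)%:R = \prod_x expR (g a x (f x))%:R :> R.
  rewrite -expR_sum -natr_sum /agree cardsE -sum1_card; congr (expR _%:R).
  by rewrite big_mkcond.
have moment_le a : \sum_(f : {ffun T -> J}) expR (agree f a)%:R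
    <= (#|J|%:R + (expR 1 - 1)) ^+ #|T| :> R.
  under eq_bigr do rewrite agreeE.
  rewrite -(bigA_distr_bigA (fun x j => expR (g a x j)%:R : R)) -prodr_const.
  apply: ler_prod => x _; apply/andP; split.
    by apply: sumr_ge0 => j _; exact: expR_ge0.
  (* [expR] is affine on bits; by [g_inj] at most one [j] agrees at [x], so the sum is at most
     [#|J| + (expR 1 - 1)]. *)
  have -> : \sum_j expR (g a x j)%:R =
      \sum_(j : J) (1 + (expR 1 - 1) * (g a x j)%:R) :> R.
    apply: eq_bigr => j _.
    by case: (g a x j); rewrite /= ?mulr0n ?mulr1n ?expR0; lra.
  rewrite big_split /= sumr_const -mulr_sumr -natr_sum lerD2l.
  rewrite -[leRHS]mulr1 ler_wpM2l // lern1.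
  have [j gj|gN] := pickP (g a x); last by rewrite big1 // => j _; rewrite gN.
  rewrite (bigD1 j) //= gj big1 // => k kj.
  by case gk: (g a x k) => //; rewrite (g_inj _ _ _ _ gk gj) eqxx in kj.
(* Summing over [a] replaces the union bound: if every [f] failed for some [a], each inner sum would
   exceed [expR (L + M)]. *)
have avg : \sum_(f : {ffun T -> J}) \sum_a expR (agree f a)%:R
    <= \sum_(f : {ffun T -> J}) expR (L + M) :> R.
  rewrite exchange_big /= (le_trans (ler_sum _ (fun a _ => moment_le a))) //.
  rewrite !sumr_const card_ffun expRD -[leLHS]mulr_natl -[leRHS]mulr_natr.
  have Je : 0 <= #|J|%:R + (expR 1 - 1) :> R by lra.
  rewrite -mulrA ler_pM ?(exprn_ge0 _ Je) ?ler0n //.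
  (* Once [#|J| ^ #|T|], the number of functions, is factored out, [1 + x <= expR x] bounds the rest
     by [expR M]. *)
  have -> : #|J|%:R + (expR 1 - 1) =
      #|J|%:R * (1 + (expR 1 - 1) / #|J|%:R) :> R.
    by field; rewrite gt_eqF.
  rewrite exprMn natrX mulrC ler_wpM2r ?exprn_ge0 ?ler0n //.
  have -> : M = #|T|%:R * ((expR 1 - 1) / #|J|%:R) by rewrite /M; ring.
  rewrite expRM_natl lerXn2r ?nnegrE ?expR_ge0 ?expR_ge1Dx //.
  by have := divr_ge0 e1 (ltW J0'); lra.
have [/existsP[f /forallP fP]|noF] :=
    boolP [exists f : {ffun T -> J}, [forall a, (agree f a)%:R <= L + M]].
  by exists f.
exfalso; move: avg; apply/negP; rewrite -ltNge.
have /card_gt0P[j _] := J0.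
apply: ltr_sum; first by apply/hasP; exists [ffun=> j]; rewrite ?mem_index_enum.
move=> f _; move/existsPn: noF => /(_ f) /forallPn[a]; rewrite -ltNge => ltLM.
rewrite (bigD1 a) //=; apply: ltr_wpDr; last by rewrite ltr_expR.
by apply: sumr_ge0 => b _; exact: expR_ge0.
Qed.

(** * Arrival orders, and what their comparisons reveal *)

(* The rank of the item arriving at time t is that of [y t] in the reverse
   order, except that the best item is moved to time [j] when [y] fixes [j]. *)
Definition arrival m (y : {perm 'I_m.+1}) (j : 'I_m.+1) : {perm 'I_m.+1} :=
  ((y * tperm j ord_max * perm rev_ord_inj)^-1)%g.

Definition head_perm m (h : nat) : finType :=
  {y : {perm 'I_m.+1} | perm_on [set t : 'I_m.+1 | (t < h)%N] y}.

Definition tail_time m (h : nat) : finType := {j : 'I_m.+1 | (h <= j)%N}.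

(** A larger [y] means a smaller rank, hence the swapped inequality. All pairs of times are covered,
    so one bit function feeds the circuits of every time. *)
Definition comparison m (y : {perm 'I_m.+1}) (p : 'I_m.+1 * 'I_m.+1) : bool :=
  (y p.2 < y p.1)%N.

Lemma rank_at_arrival m (y : {perm 'I_m.+1}) j t :
  rank_at (arrival y j) 1%g t = rev_ord (tperm j ord_max (y t)).
Proof. by rewrite /rank_at /arrival invg1 perm1 invgK !permM permE. Qed.

Lemma head_perm_fix m h (y : head_perm m h) (t : 'I_m.+1) :
  (h <= t)%N -> sval y t = t.
Proof. by move=> ht; apply: (out_perm (svalP y)); rewrite inE -leqNgt. Qed.

Lemma head_perm_lt m h (y : head_perm m h) (t j : 'I_m.+1) :
  (h <= j)%N -> (t < j)%N -> (sval y t < j)%N.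
Proof.
move=> hj tj; have [ht|th] := leqP h t; first by rewrite head_perm_fix.
have := perm_closed t (svalP y); rewrite !inE th => yh.
exact: leq_trans yh hj.
Qed.

Lemma rank_at_head m h (y : head_perm m h) (j t : 'I_m.+1) :
  (h <= j)%N -> (t < j)%N ->
  rank_at (arrival (sval y) j) 1%g t = rev_ord (sval y t).
Proof.
move=> hj tj; rewrite rank_at_arrival; have yj := head_perm_lt y hj tj.
have jm := ltn_ord j.
by move: (sval y t) yj => u yj; rewrite tpermD // -val_eqE /=; lia.
Qed.

Lemma rank_at_max m h (y : head_perm m h) (j t : 'I_m.+1) :
  (h <= j)%N -> (rank_at (arrival (sval y) j) 1%g t == 0%N :> nat) = (t == j).
Proof.
move=> hj; rewrite rank_at_arrival /=.
set u := tperm _ _ _; have um := ltn_ord u.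
have -> : (m.+1 - u.+1 == 0)%N = (u == ord_max) by rewrite -val_eqE /=; lia.
rewrite /u -[X in _ == X](tpermL j ord_max) (inj_eq perm_inj).
by rewrite -{1}(head_perm_fix y hj) (inj_eq perm_inj).
Qed.

(* Up to time [j] every tail item is a new record, so the arrival of the best
   item at time [j] goes unnoticed. *)
Lemma rank_at_lt m h (y : head_perm m h) (j a b : 'I_m.+1) :
  (h <= j)%N -> (a < b)%N -> (b <= j)%N ->
  (rank_at (arrival (sval y) j) 1%g a < rank_at (arrival (sval y) j) 1%g b)%N
  = comparison (sval y) (a, b).
Proof.
move=> hj ab bj; have aj : (a < j)%N by exact: leq_trans ab bj.
rewrite /comparison /= (rank_at_head y hj aj).
have ya := ltn_ord (sval y a); have yb := ltn_ord (sval y b).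
move: bj; rewrite leq_eqVlt => /orP[/eqP/val_inj bj|bj]; last first.
  rewrite (rank_at_head y hj bj) /=.
  by move: (sval y a) (sval y b) ya yb => u v; lia.
(* At [b = j] nothing has rank below 0, and [y] agrees: it fixes [j] and sends earlier times below
   [j]. *)
have /eqP -> : rank_at (arrival (sval y) j) 1%g b == 0%N :> nat.
  by rewrite rank_at_max // bj.
rewrite bj (head_perm_fix y hj) ltn0; apply/esym/negbTE.
rewrite -leqNgt ltnW //.
exact: head_perm_lt.
Qed.

Definition pair_times m (t : 'I_m.+1) (p : cmp_pair t.+1) : 'I_m.+1 * 'I_m.+1 :=
  (widen_ord (ltn_ord t) (val p).1, widen_ord (ltn_ord t) (val p).2).

Lemma rel_order_arrival m h (y : head_perm m h) (j t : 'I_m.+1)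
    (p : cmp_pair t.+1) :
  (h <= j)%N -> (t <= j)%N ->
  rel_order (arrival (sval y) j) 1%g t p = comparison (sval y) (pair_times p).
Proof.
move=> hj tj; rewrite ffunE -(rank_at_lt y hj) //; first exact: (valP p).
by rewrite /= (leq_trans _ tj) // -ltnS.
Qed.

(** [y t] is the number of [s] with [y s < y t], a count of comparison bits. *)
Lemma comparison_inj m : injective (@comparison m).
Proof.
move=> y z yz; apply/permP => t; apply/val_inj.
have rankE (u : {perm 'I_m.+1}) : #|[set s | comparison u (t, s)]| = u t :> nat.
  transitivity #|[set s : 'I_m.+1 | (s < u t)%N]|.
    rewrite -(card_imset _ (@perm_inj _ u)); apply: eq_card => s.
    rewrite inE; apply/imsetP/idP => [[r]|st]; first by rewrite inE => ru ->.
    by exists ((u^-1)%g s); rewrite ?inE /comparison /= permKV.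
  rewrite cardsE -sum1_card -(big_ord_widen _ (fun=> 1%N)); last exact: ltnW.
  by rewrite sum1_card card_ord.
by rewrite /= -!rankE yz.
Qed.

(** By time [t >= h] the whole head has arrived. A pair not yet seen ends in the tail, where both
    permutations give the bit [false]. *)
Lemma head_perm_eq m h (y z : head_perm m h) (j k t : 'I_m.+1) :
  (h <= t)%N -> (t <= j)%N -> (t <= k)%N ->
  rel_order (arrival (sval y) j) 1%g t = rel_order (arrival (sval z) k) 1%g t ->
  y = z.
Proof.
move=> ht tj tk E; apply/val_inj/comparison_inj.
have lt_eq (a b : 'I_m.+1) : (a < b)%N ->
    comparison (sval y) (a, b) = comparison (sval z) (a, b).
  move=> ab; have [tb|bt] := ltnP t b; last first.
    have at1 : (a < t.+1)%N by lia.
    have bt1 : (b < t.+1)%N by lia.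
    pose p : cmp_pair t.+1 := exist _ (Ordinal at1, Ordinal bt1) ab.
    have -> : (a, b) = pair_times p by congr (_, _); exact: val_inj.
    rewrite -(@rel_order_arrival _ _ _ j) ?(leq_trans ht tj) // E.
    by rewrite rel_order_arrival ?(leq_trans ht tk).
  have hb : (h <= b)%N by lia.
  rewrite /comparison /= (head_perm_fix y hb) (head_perm_fix z hb).
  by rewrite !ltnNge (ltnW (head_perm_lt y hb ab))
    (ltnW (head_perm_lt z hb ab)).
have flip (u : {perm 'I_m.+1}) (a b : 'I_m.+1) : (b < a)%N ->
    comparison u (a, b) = ~~ comparison u (b, a).
  move=> ba; rewrite /comparison /= -leqNgt ltn_neqAle val_eqE.
  by rewrite (inj_eq perm_inj) -val_eqE ltn_eqF.
apply/boolp.funext => -[a b]; case: (ltngtP a b) => ab; first exact: lt_eq.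
  by rewrite !(flip _ _ _ ab) lt_eq.
by rewrite /comparison /= (val_inj ab) !ltnn.
Qed.

Lemma card_head_perm m h : (h <= m.+1)%N -> #|head_perm m h| = h`!.
Proof.
move=> hm; rewrite card_sig -[RHS](_ : #|[set t : 'I_m.+1 | (t < h)%N]|`! = _).
  by rewrite -card_perm; apply: eq_card.
rewrite cardsE -sum1_card -(big_ord_widen _ (fun=> 1%N)) //.
by rewrite sum1_card card_ord.
Qed.

Lemma card_tail_time m h : (h <= m.+1)%N -> #|tail_time m h| = (m.+1 - h)%N.
Proof.
move=> hm; rewrite card_sig; apply: (@addnI h); rewrite subnKC //.
rewrite -[RHS](card_ord m.+1) -(cardC [pred t : 'I_m.+1 | (t < h)%N]).
congr addn; last by apply: eq_card => t; rewrite !inE -leqNgt.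
by rewrite -sum1_card -(big_ord_widen _ (fun=> 1%N)) // sum1_card card_ord.
Qed.

(** * The random arrival order, and algorithms facing it *)

Definition pushforward (R : realType) (T U : finType) (F : T -> U) :
    {ffun U -> R} := [ffun u => \sum_(x | F x == u) #|T|%:R^-1].

Lemma pushforward_sum (R : realType) (T U : finType) (F : T -> U) (P : pred U) :
  \sum_(u | P u) pushforward R F u = #|[set x | P (F x)]|%:R / #|T|%:R.
Proof.
rewrite cardsE mulrC mulr_natr -sumr_const (partition_big F P) //=.
apply: eq_bigr => u Pu; rewrite ffunE; apply: eq_bigl => x.
by rewrite unfold_in; case: eqP => [->|]; rewrite ?Pu ?andbF.
Qed.

Lemma pushforward_distribution (R : realType) (T : finType) n
    (F : T -> {perm 'I_n}) : (0 < #|T|)%N -> is_distribution (pushforward R F).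
Proof.
move=> T0; split=> [pi|].
  by rewrite ffunE; apply: sumr_ge0 => x _; rewrite invr_ge0 ler0n.
rewrite (pushforward_sum R F xpredT) cardsE cardT -cardE divff //.
by rewrite pnatr_eq0 -lt0n.
Qed.

Definition hidden_max m h (f : {ffun head_perm m h -> tail_time m h})
    (y : head_perm m h) : {perm 'I_m.+1} := arrival (sval y) (sval (f y)).

(** The rule stops at [t] when some [y] consistent with the bits has [f y = t]. A stop too early, at
    [f z], lies in the tail, so [head_perm_eq] forces [z = y], a contradiction. *)
Lemma hidden_max_found m h (f : {ffun head_perm m h -> tail_time m h}) :
  exists ALG : algorithm m.+1, forall y, selects_max ALG (hidden_max f y) 1%g.
Proof.
pose ALG : algorithm m.+1 := [ffun t : 'I_m.+1 => [ffun b : cmp_bits t.+1 =>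
  [exists y, (sval (f y) == t) && (rel_order (hidden_max f y) 1%g t == b)]]
  : {ffun cmp_bits t.+1 -> bool}].
exists ALG => y; have hf := svalP (f y).
have acc t : accepts ALG (hidden_max f y) 1%g t =
    [exists z, (sval (f z) == t) &&
    (rel_order (hidden_max f z) 1%g t == rel_order (hidden_max f y) 1%g t)].
  by rewrite /accepts !ffunE.
apply/existsP; exists (sval (f y)); rewrite rank_at_max // eqxx andbT.
apply/andP; split; first by rewrite acc; apply/existsP; exists y; rewrite !eqxx.
apply/forallP => s; apply/implyP => sf; rewrite acc; apply/existsPn => z.
apply/negP => /andP[/eqP zs /eqP E].
have hs : (h <= s)%N by rewrite -zs; exact: (svalP (f z)).
have zy : z = y by apply: head_perm_eq E; rewrite ?zs // ltnW.
by move: sf; rewrite -zs zy ltnn.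
Qed.

(** The guess at [f y]: the first time accepted when all bits are read off [y]. It does not depend
    on [f], so the union bound may range over [c] alone. *)
Definition code_selects m S
    (c : {ffun 'I_m.+1 -> circuit_code ('I_m.+1 * 'I_m.+1)%type S})
    (y : {perm 'I_m.+1}) (t : 'I_m.+1) : bool :=
  code_eval (c t) (comparison y)
  && [forall s : 'I_m.+1, (s < t)%N ==> ~~ code_eval (c s) (comparison y)].

Lemma code_selects_uniq m S
    (c : {ffun 'I_m.+1 -> circuit_code ('I_m.+1 * 'I_m.+1)%type S}) y s t :
  code_selects c y s -> code_selects c y t -> s = t.
Proof.
move=> /andP[cs /forallP fs] /andP[ct /forallP ft]; apply/val_inj.
have := fs t; have := ft s; rewrite cs ct /= !implybF.
by rewrite -!leqNgt => ts st; apply/eqP; rewrite eqn_leq ts st.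
Qed.

(** Up to time [f y] the observed bits are those of [y], so a winning run stops exactly where the
    guess does. The codes are chosen before [f]. *)
Lemma selects_max_code (R : realType) m S (ALG : algorithm m.+1) (s : R) :
  s <= S%:R -> computable_by_circuits ALG s ->
  exists c : {ffun 'I_m.+1 -> circuit_code ('I_m.+1 * 'I_m.+1)%type S},
    forall h (f : {ffun head_perm m h -> tail_time m h}) y,
      selects_max ALG (hidden_max f y) 1%g ->
      code_selects c (sval y) (sval (f y)).
Proof.
move=> sS comp.
have code (t : 'I_m.+1) : exists c : circuit_code ('I_m.+1 * 'I_m.+1)%type S,
    forall h (y : head_perm m h) (j : 'I_m.+1), (h <= j)%N -> (t <= j)%N ->
    accepts ALG (arrival (sval y) j) 1%g t = code_eval c (comparison (sval y)).
  have [k [c [ks cP]]] := comp t.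
  have kS : (k <= S)%N by rewrite -(ler_nat R); exact: le_trans sS.
  have [c' c'P] := circuit_codeP (@pair_times m t) c kS.
  exists c' => h y j hj tj; rewrite /accepts -cP; apply: c'P => p.
  exact: rel_order_arrival.
have [c cP] := boolp.choice code.
exists (finfun c) => h f y /existsP[t /andP[sel]]; have hf := svalP (f y).
rewrite rank_at_max // => /eqP tf; move: sel; rewrite tf => /andP[acc nacc].
rewrite /code_selects ffunE -(cP _ _ _ _ hf) // acc.
apply/forallP => r; apply/implyP => rf; rewrite ffunE -(cP _ _ _ _ hf (ltnW rf)).
by have /implyP/(_ rf) := forallP nacc r.
Qed.

Theorem mainTheorem13 (R : realType) :
  exists C : R, forall n : nat, (0 < n)%N -> (4 %| n)%N ->
    exists D : {ffun {perm 'I_n} -> R},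
      [/\ is_distribution D,
          opt_val D 1%g = 1 &
          forall ALG : algorithm n,
            computable_by_circuits ALG ((2 : R) `^ (n%:R / 8)) ->
            alg_val D ALG 1%g <= C / n%:R].
Proof.
(* With [n = 2h], [256 ^ h] is [2 ^ (4n)], which dominates [n ^ 3 * 2 ^ n]. *)
have [K KP] := expn_le_fact 256.
(* The first term pays for the union over circuits, the second for the mean agreement
   [1 / h = 2 / n]. *)
exists (16 * K%:R + 2 * (expR 1 - 1)) => -[//|m] _ m4.
set n := m.+1; pose h := n./2.
have nE : n = (h + h)%N.
  rewrite addnn -[LHS]odd_double_half [odd n]negbTE // -dvdn2.
  exact: dvdn_trans m4.
have h0 : (0 < h)%N by move: nE; rewrite /n; lia.
have hn : (h <= n)%N by lia.
(* One circuit per time; [L] bounds the binary logarithm of the number of such families. *)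
pose code := {ffun 'I_n -> circuit_code ('I_n * 'I_n)%type (2 ^ n)}.
pose L := (n * (16 * n * 2 ^ n))%N.
have cardT : #|head_perm m h| = h`! by exact: card_head_perm.
have cardJ : #|tail_time m h| = h by rewrite card_tail_time // -/n nE addnK.
have code_le : #|code|%:R <= expR L%:R :> R.
  rewrite card_ffun card_ord.
  apply: (@le_trans _ _ (2 ^ L)%:R).
    by rewrite ler_nat /L mulnC expnM leq_exp2r // card_circuit_code_le.
  rewrite -[L%:R]mulr1 expRM_natl natrX lerXn2r ?nnegrE ?expR_ge0 //.
  by have := expR_ge1Dx (1 : R); lra.
have [] := @hard_function R code (head_perm m h) (tail_time m h)
  (fun c y j => code_selects c (sval y) (sval j)) L%:R _ _ code_le.
- by rewrite cardJ.
- by move=> c y j k cj ck; apply/val_inj; exact: code_selects_uniq cj ck.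
move=> f fP; rewrite cardT cardJ in fP.
have T0 : (0 < #|head_perm m h|)%N by rewrite cardT fact_gt0.
have D_distr := pushforward_distribution R (hidden_max f) T0.
have valE ALG : alg_val (pushforward R (hidden_max f)) ALG 1%g
    = #|[set y | selects_max ALG (hidden_max f y) 1%g]|%:R / h`!%:R.
  by rewrite /alg_val pushforward_sum cardT.
have fact0 : 0 < h`!%:R :> R by rewrite ltr0n fact_gt0.
exists (pushforward R (hidden_max f)); split => //.
- apply/le_anti/andP; split.
    apply: bigmax_le => // ALG _; rewrite valE ler_pdivrMr // mul1r ler_nat.
    by rewrite -cardT max_card.
  have [ALG ALGP] := hidden_max_found f.
  apply: le_trans (le_bigmax _ _ ALG); rewrite valE.
  have -> : [set y | selects_max ALG (hidden_max f y) 1%g] = setT.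
    by apply/setP => y; rewrite !inE ALGP.
  by rewrite cardsT cardT divff // gt_eqF.
move=> ALG comp.
have size_le : (2 : R) `^ (n%:R / 8) <= (2 ^ n)%:R.
  rewrite natrX -powR_mulrn // ler_powR //; first by lra.
  by have : 0 <= n%:R :> R by []; lra.
have [c cP] := selects_max_code size_le comp.
have agree_le : #|[set y | selects_max ALG (hidden_max f y) 1%g]|%:R
    <= L%:R + (expR 1 - 1) * (h`!%:R / h%:R) :> R.
  apply: le_trans (fP c); rewrite ler_nat subset_leq_card //.
  by apply/subsetP => y; rewrite !inE; exact: cP.
(* This makes the union cost [L / h!] at most [16 K / n]. *)
have L_le : (L * n <= 16 * K * h`!)%N.
  have n2 : (n <= 2 ^ n)%N by apply/ltnW/ltn_expl.
  apply: (@leq_trans (16 * 256 ^ h)%N); last by rewrite -mulnA leq_mul.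
  have -> : (256 ^ h = 2 ^ n * 2 ^ n * 2 ^ n * 2 ^ n)%N.
    by rewrite -[256%N]/(2 ^ 8)%N -expnM -!expnD; congr (2 ^ _)%N; lia.
  have -> : (L * n = 16 * (n * n * n * 2 ^ n))%N by rewrite /L; lia.
  by rewrite leq_mul // !leq_mul.
rewrite valE ler_pdivrMr //.
have n0 : 0 < n%:R :> R by [].
have h0' : 0 < h%:R :> R by rewrite ltr0n.
apply: le_trans agree_le _.
rewrite -(ler_pM2r n0) [leRHS]mulrAC divfK ?gt_eqF //.
rewrite [leLHS]mulrDl [leRHS]mulrDl.
apply: lerD; first by rewrite -!natrM ler_nat.
by rewrite nE natrD le_eqVlt; apply/orP; left; apply/eqP; field; rewrite gt_eqF.
Qed.
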